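(* Let $M=T^2=\mathbb R^2/2\pi\mathbb Z^2$ with coordinates $(x,y)$, symplectic form $\omega=\mu=dx\wedge dy$, flat metric $g_0=dx^2+dy^2$ and standard complex structure $J_0$, and let $g=g_0(1+P)(1-P)^{-1}$ be an associated metric, where $P$ is given by a complex function $p$. Let $A,B\in\mathrm{End}_{SJ_0}(TM)$ be operators given by functions $\alpha$ and $\beta$, and let $h_A,h_B$ be the corresponding elements of $T_g\mathcal{AM}(T^2)$. Then the sectional curvature $K_\sigma$ of $\mathcal{AM}(T^2)$ in the plane section $\sigma$ generated by $h_A,h_B$ is $$K_\sigma=-\frac12\,\frac{\displaystyle\int_M\frac{(\mathrm{Im}(\alpha\overline\beta))^2}{(1-|p|^2)^4}d\mu}{\displaystyle\int_M\frac{|\alpha|^2}{(1-|p|^2)^2}d\mu\ \int_M\frac{|\beta|^2}{(1-|p|^2)^2}d\mu-\left(\int_M\frac{\mathrm{Re}(\overline\alpha\beta)}{(1-|p|^2)^2}d\mu\right)^2}.$$ In particular: 1) If $\alpha$ and $\beta$ are simultaneously either real or pure imaginary, then $K_\sigma=0$. 2) If one of $\alpha,\beta$ is real and the other is pure imaginary, then $$K_\sigma=-\frac12\,\frac{\displaystyle\int_M\frac{(\mathrm{Im}(\alpha\beta))^2}{(1-|p|^2)^4}d\mu}{\displaystyle\int_M\frac{|\alpha|^2}{(1-|p|^2)^2}d\mu\ \int_M\frac{|\beta|^2}{(1-|p|^2)^2}d\mu}.$$ 3) The holomorphic sectional curvature is bounded from above by a negative constant: $$K(h_A,\mathbf Jh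_A)\le-\frac1{8\pi^2}.$$
   Context: $J_0\partial_x=\partial_y$, $J_0\partial_y=-\partial_x$; the complex frame is $\frac{\partial}{\partial z}=\frac12(\partial_x-i\partial_y)$, $\frac{\partial}{\partial\overline z}=\frac12(\partial_x+i\partial_y)$. $\mathcal{AM}(T^2)$ is the space of smooth associated metrics $g(X,Y)=\omega(X,JY)$, where $J$ is an almost complex structure with $\omega(JX,JY)=\omega(X,Y)$ and $\omega(X,JX)>0$ for $X\neq0$; it carries the weak Riemannian structure $(a,b)_g=\int_M\mathrm{tr}(g^{-1}ag^{-1}b)\,d\mu$ and the complex structure $(\mathbf Ja)(X,Y)=a(X,JY)$ on $T_g\mathcal{AM}$, the space of smooth symmetric 2-forms $a$ with $a(JX,JY)=-a(X,Y)$. $\mathrm{End}_{SJ_0}(TM)$ is the space of smooth $g_0$-symmetric endomorphisms of $TM$ anticommuting with $J_0$; such an $A$ is given by a complex function $\alpha(x,y)$ on $T^2$ via $A\frac{\partial}{\partial z}=\alpha\frac{\partial}{\partial\overline z}$, $A\frac{\partial}{\partial\overline z}=\overline\alpha\frac{\partial}{\partial z}$ (similarly $B$ by $\beta$, $P$ by $p$). Every associated metric is uniquely $g(X,Y)=g_0(X,(1+P)(1-P)^{-1}Y)$ with $P\in\mathrm{End}_{SJ_0}(TM)$, $|p|<1$ (i.e. $1-P^2>0$), and $h_A=2g_0(1-P)^{-1}A(1-P)^{-1}$ is the image of $A$ under the differential at $P$ of this parametrization. The sectional curvature of $\mathcal{AM}$ in the plane spanned by linearly independent $a,b\in T_g\mathcal{AM}$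 is $\frac{1}{4\|a\wedge b\|^2}\int_M\mathrm{tr}([g^{-1}a,g^{-1}b]^2)\,d\mu$ with $\|a\wedge b\|^2=(a,a)_g(b,b)_g-(a,b)_g^2$. *)

(* Defs.v *)
From HB Require Import structures.
From mathcomp Require Import all_boot all_order all_algebra.
From mathcomp Require Import all_classical all_reals all_analysis.
From mathcomp.real_closed Require Import complex.

Set Implicit Arguments.
Unset Strict Implicit.
Unset Printing Implicit Defensive.

Import Order.TTheory GRing.Theory Num.Theory.
Import numFieldNormedType.Exports.
Local Open Scope classical_set_scope.
Local Open Scope ring_scope.

Section Torus.
Context {R : realType}.

(* A function on the torus R^2 / 2 pi Z^2 is a function on R^2 that is
   2 pi-periodic in both coordinates. *)
Definition periodic2 (f : R * R -> R) : Prop :=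
  forall x y : R, f (x + 2 * pi, y) = f (x, y) /\ f (x, y + 2 * pi) = f (x, y).

Fixpoint Ck (k : nat) (f : R * R -> R) : Prop :=
  match k with
  | 0%N => continuous f
  | k'.+1 => (forall q v : R * R, derivable f q v) /\
             (forall v : R * R, Ck k' (fun q => 'D_v f q))
  end.

Definition smooth_torus (f : R * R -> R) : Prop :=
  periodic2 f /\ forall k, Ck k f.

(* mu = dx /\ dy, on the fundamental domain. *)
Definition int_torus (f : R * R -> R) : R :=
  Rintegral (@lebesgue_measure R \x @lebesgue_measure R)%E
    (`[0, 2 * pi] `*` `[0, 2 * pi]) f.

(* Tangent vectors are columns of coordinates in the global frame (d_x, d_y).
   The same matrix type carries endomorphism fields (X |-> A X) and fields of
   bilinear forms ((X, Y) |-> X^T G Y): g(X, A Y) has matrix G *m A, and the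
   endomorphism g^-1 a defined by a(X, Y) = g(X, g^-1 a Y) is invmx G *m a. *)
Definition field2 := R * R -> 'M[R]_2.

Definition smooth_field (A : field2) : Prop :=
  forall i j, smooth_torus (fun q => A q i j).

Definition bform (G : 'M[R]_2) (X Y : 'cV[R]_2) : R :=
  (X^T *m G *m Y) ord0 ord0.

Definition omega (X Y : 'cV[R]_2) : R :=
  X ord0 ord0 * Y ord_max ord0 - X ord_max ord0 * Y ord0 ord0.

Definition g0 : 'M[R]_2 := 1%:M.

Definition dx : 'cV[R]_2 := delta_mx ord0 ord0.
Definition dy : 'cV[R]_2 := delta_mx ord_max ord0.

(* J0 dx = dy and J0 dy = - dx. *)
Definition J0 : 'M[R]_2 := delta_mx ord_max ord0 - delta_mx ord0 ord_max.

(* g is the associated metric of the almost complex structure J. *)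
Record associated_metric (g J : field2) : Prop := AssociatedMetric {
  am_smooth : smooth_field J;
  am_square : forall q, J q *m J q = - 1%:M;
  am_omega : forall q X Y, omega (J q *m X) (J q *m Y) = omega X Y;
  am_pos : forall q X, X != 0 -> 0 < omega X (J q *m X);
  am_metric : forall q X Y, bform (g q) X Y = omega X (J q *m Y)
}.

(* (bJ a)(X, Y) = a(X, J Y). *)
Definition bJ (J a : field2) : field2 := fun q => a q *m J q.

Record EndSJ0 (A : field2) : Prop := MkEndSJ0 {
  end_smooth : smooth_field A;
  end_sym : forall q X Y, bform g0 (A q *m X) Y = bform g0 X (A q *m Y);
  end_anti : forall q, A q *m J0 = - (J0 *m A q)
}.

Definition toC {m n} (A : 'M[R]_(m, n)) : 'M[R[i]]_(m, n) :=
  map_mx (real_complex R) A.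

Definition dz : 'cV[R[i]]_2 := 2^-1 *: (toC dx - 'i%C *: toC dy).
Definition dzbar : 'cV[R[i]]_2 := 2^-1 *: (toC dx + 'i%C *: toC dy).

(* The operator A is given by the complex function alpha; A acts
   complex-linearly on the complexified tangent space. Periodicity and
   smoothness of alpha follow from those of A. *)
Definition given_by (A : field2) (alpha : R * R -> R[i]) : Prop :=
  forall q, toC (A q) *m dz = alpha q *: dzbar /\
            toC (A q) *m dzbar = conjc (alpha q) *: dz.

Definition metric_of (P : field2) : field2 :=
  fun q => g0 *m ((1%:M + P q) *m invmx (1%:M - P q)).

Definition tangent_of (P A : field2) : field2 :=
  fun q => 2 *: (g0 *m (invmx (1%:M - P q) *m A q *m invmx (1%:M - P q))).

Definition raise (g a : field2) : field2 := fun q => invmx (g q) *m a q.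

Definition inner (g a b : field2) : R :=
  int_torus (fun q => \tr (raise g a q *m raise g b q)).

Definition wedge_norm2 (g a b : field2) : R :=
  inner g a a * inner g b b - inner g a b ^+ 2.

Definition comm_mx2 (A B : 'M[R]_2) : 'M[R]_2 := A *m B - B *m A.

(* Sectional curvature of the space of associated metrics at g in the plane
   spanned by linearly independent a and b. *)
Definition sectional_curvature (g a b : field2) : R :=
  (4 * wedge_norm2 g a b)^-1 *
  int_torus (fun q => \tr (comm_mx2 (raise g a q) (raise g b q) *m
                           comm_mx2 (raise g a q) (raise g b q))).

Definition lin_indep (a b : field2) : Prop :=
  forall s t : R, (forall q, s *: a q + t *: b q = 0) -> s = 0 /\ t = 0.

Definition real_valued (f : R * R -> R[i]) : Prop :=
  forall q, complex.Im (f q) = 0.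

Definition imaginary_valued (f : R * R -> R[i]) : Prop :=
  forall q, complex.Re (f q) = 0.

Definition cabs (z : R[i]) : R := ComplexField.Normc.normc z.

End Torus.

(* Main.v *)
Require Import Defs.
From mathcomp Require Import all_boot all_order all_algebra.
From mathcomp Require Import all_classical all_reals all_analysis.
From mathcomp.real_closed Require Import complex.
From mathcomp Require Import measurable_realfun ring lra.
Import Order.TTheory GRing.Theory Num.Theory.
Import numFieldNormedType.Exports.
Local Open Scope classical_set_scope.
Local Open Scope ring_scope.

(** The curvature is an integral of pointwise traces, so the theorem rests on
    linear algebra in one tangent space.  With [N = 1 - P], the identity
    [(1 - P)(1 + P) = 1 - |p|^2] turns [g^-1 h_A] into
    [2 / (1 - |p|^2) . N A N^-1] ([raise_tangent_of]).  Conjugation by [N]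
    disappears under the trace, so at every metric only the traces of [A B] and
    of [[A, B]^2] at the flat metric matter; these are [2 Re(conj alpha beta)]
    and [-8 (Im(alpha conj beta))^2].  Integrating gives the curvature formula
    ([curvature_formula]), and cases 1) and 2) follow because [Im(alpha conj
    beta)], respectively [Re(conj alpha beta)], vanishes identically.

    For the holomorphic curvature, an associated complex structure is
    [J = J0 g], and [J0] anticommutes with [P], so that [g^-1 (J h_A)] is again
    [2 / (1 - |p|^2) . N (A J0) N^-1], where [A J0] is given by [i alpha].  The
    cross term vanishes and, with [f = |alpha|^2 / (1 - |p|^2)^2], the
    curvature is [-1/2 (int f^2) / (int f)^2].  The Cauchy-Schwarz inequality
    [(int f)^2 <= (2 pi)^2 int f^2] ([int_torus_sqr]) gives the bound, provided
    that [int f > 0] ([int_torus_gt0]), which holds since [f] is continuous,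
    nonnegative, and not identically zero.

    On the analytic side every integrand is continuous on the plane; such a
    function is measurable for the product sigma-algebra and bounded on the
    fundamental square, hence integrable ([torus_integrable]). *)

(** * Integration over the torus *)

Section TorusIntegral.
Context {R : realType}.
Implicit Types (f g : R * R -> R).

Local Notation mu := (@lebesgue_measure R \x @lebesgue_measure R)%E.
Local Notation S :=
  ((`[0, 2 * pi] `*` `[0, 2 * pi]) : set (measurableTypeR R * measurableTypeR R)).

(** Rational boxes form a countable base of the plane, so the product
    sigma-algebra contains every open set. *)
Lemma open_measurable2 (U : set (R * R)) : open U ->
  measurable (U : set (measurableTypeR R * measurableTypeR R)).
Proof.
move=> oU.
pose box (k : rat * rat * nat) : set (measurableTypeR R * measurableTypeR R) :=
  ball (ratr k.1.1 : R) (k.2.+1%:R^-1 : R) `*` ball (ratr k.1.2 : R) (k.2.+1%:R^-1 : R).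
have -> : U = \bigcup_(k in [set k | box k `<=` U]) box k.
  rewrite eqEsubset; split; last by move=> q [k /= kU /kU].
  move=> [x y] Uq.
  have /nbhs_ballP[e /= e0 eU] : nbhs (x, y) U by exact: open_nbhs_nbhs.
  have e20 : 0 < e / 2 by rewrite divr_gt0.
  have [n _ /(_ n (leqnn n)) ne] := near_infty_natSinv_lt (PosNum e20).
  set r : R := n.+1%:R^-1.
  have r0 : 0 < r by rewrite invr_gt0.
  have [a] := @rat_in_itvoo R (x - r) (x + r) ltac:(lra).
  have [b] := @rat_in_itvoo R (y - r) (y + r) ltac:(lra).
  rewrite !in_itv/= => /andP[b1 b2] /andP[a1 a2].
  exists (a, b, n) => /=; last first.
    by split; rewrite /= /ball /= -/r ltr_norml; apply/andP; split; lra.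
  move=> [x' y'] [/=]; rewrite /ball /= -/r !ltr_norml => /andP[c1 c2] /andP[d1 d2].
  have re : r < e / 2 by exact: ne.
  apply: eU; split; rewrite /= /ball /= ltr_norml; apply/andP; split; lra.
rewrite bigcup_mkcond; apply: countable_bigcupT_measurable => [|k]; first exact: countableP.
by case: ifPn => // _; apply: measurableX; exact: measurable_ball.
Qed.

Lemma continuous_measurable_fun2 f : continuous f ->
  measurable_fun (setT : set (measurableTypeR R * measurableTypeR R)) f.
Proof.
move=> /continuousP cf; apply: (measurability _ (RGenOpens.measurableE R)).
move=> _ [_ [a [b ->] <-]]; rewrite setTI; apply: open_measurable2.
exact/cf/interval_open.
Qed.

Lemma measurable_square : measurable S.
Proof. by apply: measurableX; exact: measurable_itv. Qed.

Lemma measure_box (a b c d : R) : a < b -> c < d ->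
  mu (`[a, b] `*` `[c, d]) = ((b - a) * (d - c))%:E.
Proof.
move=> ab cd; rewrite product_measure1E //.
by rewrite /= !lebesgue_measure_itv /= !lte_fin ab cd -!EFinB -EFinM.
Qed.

Lemma torus_integrable {f} : continuous f -> mu.-integrable S (EFin \o f).
Proof.
move=> cf; apply: measurable_bounded_integrable.
- exact: measurable_square.
- by rewrite [X in (X < _)%E]measure_box ?ltry // mulr_gt0 // pi_gt0.
- by apply: measurable_funTS; exact: continuous_measurable_fun2.
- have cS : compact (`[0, 2 * pi] `*` `[0, 2 * pi] : set (R * R)).
    by apply: compact_setX; exact: segment_compact.
  have cfS : {within `[0, 2 * pi] `*` `[0, 2 * pi], continuous f}.
    exact: continuous_subspaceT.
  have /compact_bounded[M [_ mrt]] := continuous_compact cfS cS.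
  by exists M; split; rewrite ?num_real // => ? ? ? ?; exact: mrt.
Qed.

Lemma int_torusZ c {f} : continuous f ->
  int_torus (fun q => c * f q) = c * int_torus f.
Proof.
by move=> cf; apply: RintegralZl; [exact: measurable_square|exact: torus_integrable].
Qed.

Lemma int_torus0 : int_torus (fun=> 0 : R) = 0.
Proof. by rewrite /int_torus Rintegral_cst ?mul0r //; exact: measurable_square. Qed.

(** Cauchy-Schwarz against the constant 1, by integrating [(f - m)^2 >= 0] for
    [m] the mean value of [f]; the area of the torus is [(2 pi)^2]. *)
Lemma int_torus_sqr {f} : continuous f ->
  int_torus f ^+ 2 <= (2 * pi) ^+ 2 * int_torus (fun q => f q ^+ 2).
Proof.
move=> cf.
have pi0 : 0 < (2 * pi) ^+ 2 :> R by rewrite exprn_gt0 // mulr_gt0 // pi_gt0.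
set V := (2 * pi) ^+ 2 in pi0 *; set I := int_torus f.
set N := int_torus _; pose m := I / V.
have cf2 : continuous (fun q => f q ^+ 2).
  by move=> q; exact: (continuousM (cf q) (cf q)).
have cmf : continuous (fun q => 2 * m * f q).
  by move=> q; exact: (continuousM (@cst_continuous _ _ (2 * m) q) (cf q)).
have cm : continuous (fun _ : R * R => m ^+ 2) by exact: cst_continuous.
have cg : continuous (fun q => f q ^+ 2 - 2 * m * f q).
  by move=> q; exact: (continuousB (cf2 q) (cmf q)).
have Im : int_torus (fun _ : R * R => m ^+ 2) = m ^+ 2 * V.
  rewrite /int_torus Rintegral_cst; last exact: measurable_square.
  by rewrite [X in fine X]measure_box ?mulr_gt0 ?pi_gt0 //= !subr0.
have : 0 <= int_torus (fun q => (f q ^+ 2 - 2 * m * f q) + m ^+ 2).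
  apply: Rintegral_ge0 => q _.
  have -> : f q ^+ 2 - 2 * m * f q + m ^+ 2 = (f q - m) ^+ 2 by ring.
  exact: sqr_ge0.
rewrite {1}/int_torus RintegralD; [|exact: measurable_square|exact: torus_integrable..].
rewrite -/(int_torus (fun q => m ^+ 2)) Im.
rewrite RintegralB; [|exact: measurable_square|exact: torus_integrable..].
rewrite -/(int_torus (fun q => f q ^+ 2)) -/(int_torus (fun q => 2 * m * f q)).
rewrite int_torusZ // -/I -/N.
have -> : N - 2 * m * I + m ^+ 2 * V = (V * N - I ^+ 2) / V.
  by rewrite /m; field; rewrite gt_eqF.
by rewrite pmulr_lge0 ?invr_gt0 // subr_ge0.
Qed.

Lemma periodic_reduce {h : R -> R} {T : R} (x : R) :
  0 < T -> (forall x, h (x + T) = h x) -> exists2 y, 0 <= y < T & h y = h x.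
Proof.
move=> T0 hT.
have hn n y : h (y + T *+ n) = h y by exact: (@periodicn R R h T hT n y).
have hz (z : int) y : h (y + T *~ z) = h y.
  by case: z => n; [exact: hn|rewrite NegzE mulrNz -(hn n.+1) subrK].
exists (x - T *~ Num.floor (x / T)); last by rewrite -mulrNz hz.
rewrite -mulrzr.
have := Num.Theory.floor_itv (x / T).
rewrite ler_pdivlMr // ltr_pdivrMr // intrD mulrDl mul1r => /andP[? ?].
by apply/andP; split; lra.
Qed.

(** Periodicity moves a point of positivity into the half-open square
    [[0, 2 pi[ x [0, 2 pi[].  There it is the lower left corner of a
    nondegenerate box that stays in the closed square and on which [f] exceeds
    half its value at the corner. *)
Lemma int_torus_gt0 {f} q : continuous f -> periodic2 f ->
  (forall q, 0 <= f q) -> 0 < f q -> 0 < int_torus f.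
Proof.
move=> cf pf f0; case: q => x y fxy.
have T0 : 0 < 2 * pi :> R by rewrite mulr_gt0 // pi_gt0.
have [x' x'T ex] := periodic_reduce x T0 (fun x => (pf x y).1).
have [y' y'T ey] := periodic_reduce y T0 (fun y => (pf x' y).2).
move: fxy; rewrite -ex -ey => {x y ex ey}.
set c := f (x', y') => c0.
have nb : nbhs (x', y') (f @^-1` `]c / 2, +oo[).
  apply: cf; apply: open_nbhs_nbhs; split; first exact: interval_open.
  by rewrite /= in_itv /= andbT -/c; lra.
have /nbhs_ballP[e /= e0 eU] := nb.
pose x2 := Num.min (x' + e / 2) (2 * pi); pose y2 := Num.min (y' + e / 2) (2 * pi).
have xx2 : x' < x2 by rewrite lt_min; apply/andP; split; lra.
have yy2 : y' < y2 by rewrite lt_min; apply/andP; split; lra.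
have [x2e x2T] : x2 <= x' + e / 2 /\ x2 <= 2 * pi by rewrite !ge_min !lexx orbT.
have [y2e y2T] : y2 <= y' + e / 2 /\ y2 <= 2 * pi by rewrite !ge_min !lexx orbT.
pose B : set (measurableTypeR R * measurableTypeR R) := `[x', x2] `*` `[y', y2].
have mB : measurable B by apply: measurableX; exact: measurable_itv.
have BS : B `<=` S.
  move=> [a b] [/=]; rewrite !in_itv /= => /andP[? ?] /andP[? ?].
  by split; rewrite /= ?in_itv; apply/andP; split; lra.
have fB q : B q -> c / 2 <= f q.
  case: q => x y [/=]; rewrite !in_itv /= => /andP[? ?] /andP[? ?].
  have /eU /= : ball (x', y') e (x, y).
    by split; rewrite /= /ball /= ltr_norml; apply/andP; split; lra.
  by rewrite in_itv /= andbT => /ltW.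
have iS := torus_integrable cf.
have iB := integrableS measurable_square mB BS iS.
have -> : int_torus f = Rintegral mu B f + Rintegral mu (S `\` B) f.
  rewrite -Rintegral_setU //.
  - by rewrite setDUK.
  - by apply: measurableD => //; exact: measurable_square.
  - by rewrite setDUK.
  - by apply/disj_setPS => z [? []].
apply: ltr_wpDr; first by apply: Rintegral_ge0.
apply: (@lt_le_trans _ _ (Rintegral mu B (fun=> c / 2))).
  rewrite Rintegral_cst // [X in fine X]measure_box //=.
  by rewrite !mulr_gt0 // ?invr_gt0 ?subr_gt0.
apply: le_Rintegral => //.
by apply: integrableS BS _ => //; [exact: measurable_square|apply: torus_integrable; exact: cst_continuous].
Qed.

End TorusIntegral.

(** * Linear algebra in one tangent space *)

Lemma sum_ord2 (V : nmodType) (F : 'I_2 -> V) :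
  \sum_i F i = F ord0 + F ord_max.
Proof.
rewrite !big_ord_recl big_ord0 addr0; congr (_ + F _); exact: val_inj.
Qed.

Lemma matrix2P (T : Type) (M N : 'M[T]_2) :
  M ord0 ord0 = N ord0 ord0 -> M ord0 ord_max = N ord0 ord_max ->
  M ord_max ord0 = N ord_max ord0 -> M ord_max ord_max = N ord_max ord_max ->
  M = N.
Proof.
move=> e00 e01 e10 e11; apply/matrixP.
have P2 (Q : 'I_2 -> Prop) : Q ord0 -> Q ord_max -> forall i, Q i.
  move=> Q0 Q1 -[[|[|//]] i2]; first by rewrite (_ : Ordinal i2 = ord0) //; exact: val_inj.
  by rewrite (_ : Ordinal i2 = ord_max) //; exact: val_inj.
by apply: (P2); apply: (P2).
Qed.

Section Fibre.
Context {R : realType}.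
Implicit Types (z t : R[i]) (M N : 'M[R]_2).

(** The real matrix, in the frame of coordinate fields, of the endomorphism that
    sends d/dz to [z] times d/dzbar. *)
Definition antilinear_mx z : 'M[R]_2 :=
  \matrix_(i, j) if i == j then (-1) ^+ i * complex.Re z else - complex.Im z.

Lemma cabs_sqr z : cabs z ^+ 2 = complex.Re z ^+ 2 + complex.Im z ^+ 2.
Proof. by case: z => a b; rewrite /cabs /= sqr_sqrtr // addr_ge0 // sqr_ge0. Qed.

Lemma cabs_ge0 z : 0 <= cabs z.
Proof. by case: z => a b; exact: sqrtr_ge0. Qed.

Lemma cabs_gt0 z : z != 0 -> 0 < cabs z.
Proof.
move=> z0; rewrite lt_def cabs_ge0 andbT; apply: contra z0 => /eqP.
by move/ComplexField.Normc.eq0_normc ->.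
Qed.

(** The real matrix of [A] is read off its action on d/dz alone: each row of the
    complex equation gives two real entries. *)
Lemma given_by_mx {A : R * R -> 'M[R]_2} {alpha : R * R -> R[i]} q :
  given_by A alpha -> A q = antilinear_mx (alpha q).
Proof.
move=> /(_ q) [/matrixP Adz _].
have := Adz ord0 ord0; have := Adz ord_max ord0.
rewrite !mxE !sum_ord2 !mxE /=.
case: (alpha q) => a b E1 E0.
have two : (2 : R[i])^-1 != 0 by rewrite invr_eq0 pnatr_eq0.
have {}E1 : (A q ord_max ord0)%:C%C - 'i%C * (A q ord_max ord_max)%:C%C =
            (a +i* b)%C * 'i%C.
  by apply: (mulfI two); apply: etrans (etrans _ E1) _;
    rewrite ?(mulr0, mulr1, subr0, add0r, sub0r); ring.
have {}E0 : (A q ord0 ord0)%:C%C - 'i%C * (A q ord0 ord_max)%:C%C =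
            (a +i* b)%C.
  by apply: (mulfI two); apply: etrans (etrans _ E0) _;
    rewrite ?(mulr0, mulr1, subr0, add0r, sub0r, addr0); ring.
move: E1 E0 => [r10 i10] [r00 i00].
by apply: matrix2P; rewrite mxE /= ?expr0 ?expr1; lra.
Qed.

Lemma mul_antilinear_mx z t :
  antilinear_mx z *m antilinear_mx t =
  \matrix_(i, j) if i == j then complex.Re (conjc z * t)
                 else (-1) ^+ i * complex.Im (z * conjc t).
Proof.
by case: z t => a b [c d]; apply: matrix2P; rewrite !mxE sum_ord2 !mxE /= ?expr0 ?expr1; ring.
Qed.

Lemma antilinear_mx_sqr z : antilinear_mx z *m antilinear_mx z = (cabs z ^+ 2)%:M.
Proof.
rewrite mul_antilinear_mx cabs_sqr; case: z => a b.
by apply: matrix2P; rewrite !mxE /= ?expr0 ?expr1; ring.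
Qed.

Lemma tr_mul_antilinear_mx z t :
  \tr (antilinear_mx z *m antilinear_mx t) = 2 * complex.Re (conjc z * t).
Proof.
by rewrite mul_antilinear_mx /mxtrace sum_ord2 !mxE /= ?expr0 ?expr1; ring.
Qed.

Lemma tr_comm_antilinear_mx z t :
  \tr (comm_mx2 (antilinear_mx z) (antilinear_mx t) *m
       comm_mx2 (antilinear_mx z) (antilinear_mx t)) =
  - 8 * complex.Im (z * conjc t) ^+ 2.
Proof.
rewrite /comm_mx2 !mul_antilinear_mx /mxtrace; case: z t => a b [c d].
by rewrite !(sum_ord2, mxE) /= ?expr0 ?expr1; ring.
Qed.

Lemma antilinear_mx_J0 z : antilinear_mx z *m J0 = antilinear_mx ('i%C * z).
Proof.
by case: z => a b; apply: matrix2P; rewrite !(sum_ord2, mxE) /= ?expr0 ?expr1; ring.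
Qed.

Lemma J0_antilinear_mx z : J0 *m antilinear_mx z = - (antilinear_mx z *m J0).
Proof.
by case: z => a b; apply: matrix2P; rewrite !(sum_ord2, mxE) /= ?expr0 ?expr1; ring.
Qed.

(** [g(X, Y) = omega(X, J Y)] reads [g = W J] with [W] the matrix of [omega], and
    [W^-1 = J0]. *)
Lemma associated_metricJ {g J : R * R -> 'M[R]_2} q :
  associated_metric g J -> J q = J0 *m g q.
Proof.
case=> _ _ _ _ /(_ q) gJ.
have {}gJ (i j : 'I_2) :
    g q i j = omega (delta_mx i ord0) (J q *m delta_mx j ord0).
  by rewrite -gJ /bform trmx_delta -rowE -colE !mxE.
by apply: matrix2P; rewrite !(sum_ord2, mxE) !gJ /omega -!colE !mxE /= ?expr0 ?expr1; ring.
Qed.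

Section Conjugation.
Variables (N : 'M[R]_2).
Hypothesis uN : N \in unitmx.

Lemma conj_mxM M1 M2 :
  (N *m M1 *m invmx N) *m (N *m M2 *m invmx N) = N *m (M1 *m M2) *m invmx N.
Proof. by rewrite !mulmxA mulmxKV. Qed.

Lemma tr_conj_mx M : \tr (N *m M *m invmx N) = \tr M.
Proof. by rewrite mxtrace_mulC mulmxA mulVmx // mul1mx. Qed.

Lemma comm_conj_mx c M1 M2 :
  comm_mx2 (c *: (N *m M1 *m invmx N)) (c *: (N *m M2 *m invmx N)) =
  c ^+ 2 *: (N *m comm_mx2 M1 M2 *m invmx N).
Proof.
rewrite /comm_mx2 -!scalemxAl -!scalemxAr !scalerA !conj_mxM -expr2.
by rewrite mulmxBr mulmxBl scalerBr.
Qed.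
End Conjugation.

Lemma one_sub_cabs_gt0 z : cabs z < 1 -> 0 < 1 - cabs z ^+ 2.
Proof.
by move=> z1; rewrite subr_gt0 exprn_ilt1 // cabs_ge0.
Qed.

(** The endomorphism squares to the scalar [|z|^2], so [1 - P] and [1 + P] are
    inverse up to the factor [1 - |z|^2]. *)
Lemma cayley_mx {z} : cabs z < 1 ->
  let N := 1%:M - antilinear_mx z in let N' := 1%:M + antilinear_mx z in
  [/\ N *m N' = (1 - cabs z ^+ 2)%:M, N \in unitmx & N' \in unitmx].
Proof.
move=> z1 N N'; set w := 1 - _.
have NN : N *m N' = w%:M.
  rewrite mulmxDr mulmx1 mulmxBl mul1mx addrA subrK antilinear_mx_sqr.
  by rewrite /w raddfB.
have : N *m N' \in unitmx.
  rewrite NN unitmxE det_scalar unitrX // unitfE gt_eqF //.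
  exact: one_sub_cabs_gt0.
by rewrite unitmx_mul => /andP[].
Qed.

(** Since [g^-1 = N (1 + P)^-1] and one of the factors [N^-1] of [h_A] is
    [(1 + P) / (1 - |p|^2)], the factors [1 + P] cancel. *)
Lemma raise_tangent_of (P A : R * R -> 'M[R]_2) q z :
  P q = antilinear_mx z -> cabs z < 1 ->
  raise (metric_of P) (tangent_of P A) q =
  (2 / (1 - cabs z ^+ 2)) *:
    ((1%:M - P q) *m A q *m invmx (1%:M - P q)).
Proof.
move=> Pq z1; rewrite /raise /metric_of /tangent_of Pq.
have [] := cayley_mx z1; set N := 1%:M - _; set N' := 1%:M + _; set w := 1 - _.
move=> NN uN uN'; have w0 : w != 0 by rewrite gt_eqF // one_sub_cabs_gt0.
have iN : invmx N = w^-1 *: N'.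
  by rewrite -[N'](mulKmx uN) NN mul_mx_scalar scalerK.
have iG : invmx (N' *m invmx N) = N *m invmx N'.
  have uNV : invmx N \in unitmx by rewrite unitmx_inv.
  have uG : N' *m invmx N \in unitmx by rewrite unitmx_mul uN' uNV.
  have GN : (N' *m invmx N) *m (N *m invmx N') = 1%:M.
    by rewrite mulmxA mulmxKV // mulmxV.
  by rewrite -[RHS](mulKmx uG) GN mulmx1.
rewrite /g0 !mul1mx iG -scalemxAr {1}iN -!scalemxAl -scalemxAr scalerA.
by rewrite !mulmxA mulmxKV.
Qed.

(** [J = J0 (1 + P) N^-1 = N J0 N^-1], as [J0] anticommutes with [P]; it is
    absorbed by the conjugation in [raise_tangent_of]. *)
Lemma raise_bJ_tangent_of (P A J : R * R -> 'M[R]_2) q z :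
  associated_metric (metric_of P) J -> P q = antilinear_mx z -> cabs z < 1 ->
  raise (metric_of P) (bJ J (tangent_of P A)) q =
  (2 / (1 - cabs z ^+ 2)) *:
    ((1%:M - P q) *m (A q *m J0) *m invmx (1%:M - P q)).
Proof.
move=> hJ Pq z1; set h := tangent_of P A.
have -> : raise (metric_of P) (bJ J h) q = raise (metric_of P) h q *m J q.
  by rewrite /raise /bJ mulmxA.
rewrite (raise_tangent_of P A q z Pq z1) -scalemxAl; congr (_ *: _).
rewrite (associated_metricJ q hJ) /metric_of /g0 !mul1mx Pq.
have [_ uN _] := cayley_mx z1.
have JN : J0 *m (1%:M + antilinear_mx z) = (1%:M - antilinear_mx z) *m J0.
  (* J0 is itself a difference, so distributivity is told where to apply. *)
  rewrite (mulmxDr J0) (mulmxBl 1%:M _ J0) mul1mx mulmx1.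
  by rewrite J0_antilinear_mx.
rewrite [J0 *m _]mulmxA JN.
by rewrite !mulmxA mulmxKV.
Qed.
End Fibre.

(** * Curvature as an integral over the torus *)

Section Curvature.
Context {R : realType}.
Implicit Types (w : R * R -> R) (alpha beta : R * R -> R[i]).

Definition cplx_continuous alpha :=
  continuous (fun q => complex.Re (alpha q)) /\
  continuous (fun q => complex.Im (alpha q)).

Lemma cplx_continuousM {alpha beta} : cplx_continuous alpha ->
  cplx_continuous beta -> cplx_continuous (fun q => alpha q * beta q).
Proof.
move=> [ra ia] [rb ib]; split.
  rewrite (_ : (fun q => _) = fun q => complex.Re (alpha q) * complex.Re (beta q) -
    complex.Im (alpha q) * complex.Im (beta q)); last first.
    by apply/funext => q; case: (alpha q) (beta q) => a b [].
  move=> q.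
  exact: continuousB (continuousM (ra q) (rb q)) (continuousM (ia q) (ib q)).
rewrite (_ : (fun q => _) = fun q => complex.Re (alpha q) * complex.Im (beta q) +
  complex.Im (alpha q) * complex.Re (beta q)); last first.
  by apply/funext => q; case: (alpha q) (beta q) => a b [].
move=> q.
exact: continuousD (continuousM (ra q) (ib q)) (continuousM (ia q) (rb q)).
Qed.

Lemma cplx_continuous_conjc {alpha} : cplx_continuous alpha ->
  cplx_continuous (fun q => conjc (alpha q)).
Proof.
move=> [ra ia]; split.
  rewrite (_ : (fun q => _) = fun q => complex.Re (alpha q)) //.
  by apply/funext => q; case: (alpha q).
rewrite (_ : (fun q => _) = fun q => - complex.Im (alpha q)).
  by move=> q; exact: continuousN (ia q).
by apply/funext => q; case: (alpha q).
Qed.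

Lemma given_by_continuous {A : R * R -> 'M[R]_2} {alpha} :
  EndSJ0 A -> given_by A alpha -> cplx_continuous alpha.
Proof.
case=> sA _ _ hA; split.
  rewrite (_ : (fun q => _) = fun q => A q ord0 ord0).
    by have [_ /(_ 0%N)] := sA ord0 ord0.
  by apply/funext => q; rewrite (given_by_mx _ hA) mxE /= expr0 mul1r.
rewrite (_ : (fun q => _) = fun q => - A q ord0 ord_max).
  have [_ /(_ 0%N) /= cA] := sA ord0 ord_max.
  by move=> q; exact: continuousN (cA q).
by apply/funext => q; rewrite (given_by_mx _ hA) mxE /= opprK.
Qed.

Lemma cabs_sqr_conjc (z : R[i]) : cabs z ^+ 2 = complex.Re (conjc z * z).
Proof. by rewrite cabs_sqr; case: z => a b /=; ring. Qed.

Lemma continuous_exprn (f : R * R -> R) n :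
  continuous f -> continuous (fun q => f q ^+ n).
Proof. 
move=> cf q.
apply: (@continuous_comp _ _ _ f (fun x => x ^+ n)); first exact: cf.
exact: exprn_continuous.
Qed.

Lemma continuous_divX (f w : R * R -> R) n :
  continuous f -> continuous w -> (forall q, w q != 0) ->
  continuous (fun q => f q / w q ^+ n).
Proof.
move=> cf cw w0 q; apply: (@continuousM _ _ f (fun q => (w q ^+ n)^-1)).
  exact: cf.
apply: (@continuousV _ _ (fun q => w q ^+ n)); first by rewrite expf_neq0.
exact: continuous_exprn.
Qed.

Section Formula.
Context {g a b N : R * R -> 'M[R]_2} {w : R * R -> R}.
Context {alpha beta : R * R -> R[i]}.
Hypotheses (uN : forall q, N q \in unitmx) (w0 : forall q, w q != 0).
Hypothesis cw : continuous w.
Hypotheses (ca : cplx_continuous alpha) (cb : cplx_continuous beta).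
Hypothesis ra : forall q, raise g a q =
  (2 / w q) *: (N q *m antilinear_mx (alpha q) *m invmx (N q)).
Hypothesis rb : forall q, raise g b q =
  (2 / w q) *: (N q *m antilinear_mx (beta q) *m invmx (N q)).

Lemma inner_formula :
  inner g a b =
  8 * int_torus (fun q => complex.Re (conjc (alpha q) * beta q) / w q ^+ 2).
Proof.
rewrite -int_torusZ; last first.
  apply: continuous_divX => //.
  by case: (cplx_continuousM (cplx_continuous_conjc ca) cb).
congr int_torus; apply/funext => q.
rewrite ra rb -scalemxAl -scalemxAr scalerA conj_mxM // linearZ /= tr_conj_mx //.
by rewrite tr_mul_antilinear_mx; field; exact: w0.
Qed.

Lemma curvature_integral :
  int_torus (fun q => \tr (comm_mx2 (raise g a q) (raise g b q) *m
                           comm_mx2 (raise g a q) (raise g b q))) =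
  - 128 *
  int_torus (fun q => complex.Im (alpha q * conjc (beta q)) ^+ 2 / w q ^+ 4).
Proof.
rewrite -int_torusZ; last first.
  apply: continuous_divX => //; apply: continuous_exprn.
  by case: (cplx_continuousM ca (cplx_continuous_conjc cb)).
congr int_torus; apply/funext => q.
rewrite ra rb comm_conj_mx // -scalemxAl -scalemxAr scalerA conj_mxM //.
rewrite linearZ /= tr_conj_mx // tr_comm_antilinear_mx.
by field; exact: w0.
Qed.
End Formula.

(** Both the commutator integral and the squared area of the parallelogram are scalar
    multiples of the integrals displayed, by [- 128] and [64].  The quotient
    identity survives a vanishing denominator, where both sides are 0. *)
Lemma curvature_formula (g a b N : R * R -> 'M[R]_2) w alpha beta :
  (forall q, N q \in unitmx) -> (forall q, w q != 0) -> continuous w ->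
  cplx_continuous alpha -> cplx_continuous beta ->
  (forall q, raise g a q =
    (2 / w q) *: (N q *m antilinear_mx (alpha q) *m invmx (N q))) ->
  (forall q, raise g b q =
    (2 / w q) *: (N q *m antilinear_mx (beta q) *m invmx (N q))) ->
  sectional_curvature g a b = - (1 / 2) *
    (int_torus (fun q => complex.Im (alpha q * conjc (beta q)) ^+ 2 / w q ^+ 4) /
     (int_torus (fun q => cabs (alpha q) ^+ 2 / w q ^+ 2) *
      int_torus (fun q => cabs (beta q) ^+ 2 / w q ^+ 2) -
      int_torus (fun q =>
        complex.Re (conjc (alpha q) * beta q) / w q ^+ 2) ^+ 2)).
Proof.
move=> uN w0 cw ca cb ra rb.
have sqE gamma : (fun q => cabs (gamma q) ^+ 2 / w q ^+ 2) =
    (fun q => complex.Re (conjc (gamma q) * gamma q) / w q ^+ 2).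
  by apply/funext => q; rewrite cabs_sqr_conjc.
rewrite /sectional_curvature (curvature_integral uN w0 cw ca cb ra rb).
rewrite /wedge_norm2 (inner_formula uN w0 cw ca ca ra ra).
rewrite (inner_formula uN w0 cw cb cb rb rb).
rewrite (inner_formula uN w0 cw ca cb ra rb) -!sqE.
set X := int_torus _; set Y := int_torus _; set Z := int_torus _; set I := int_torus _.
have -> : 4 * (8 * X * (8 * Y) - (8 * Z) ^+ 2) = 256 * (X * Y - Z ^+ 2) by ring.
by rewrite invfM; move: ((_ - Z ^+ 2)^-1) => d; field.
Qed.

(** For [beta = i alpha] one has [Im(alpha conj beta) = - |alpha|^2] and
    [Re(conj alpha beta) = 0], so the quotient is [(int f^2) / (int f)^2] for
    [f = |alpha|^2 / w^2]. *)
Lemma holomorphic_bound alpha w (q : R * R) :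
  cplx_continuous alpha -> continuous w -> (forall q, 0 < w q) ->
  periodic2 (fun q => cabs (alpha q) ^+ 2 / w q ^+ 2) -> alpha q != 0 ->
  - (1 / 2) *
    (int_torus (fun q => complex.Im (alpha q * conjc ('i%C * alpha q)) ^+ 2 / w q ^+ 4) /
     (int_torus (fun q => cabs (alpha q) ^+ 2 / w q ^+ 2) *
      int_torus (fun q => cabs ('i%C * alpha q) ^+ 2 / w q ^+ 2) -
      int_torus (fun q =>
        complex.Re (conjc (alpha q) * ('i%C * alpha q)) / w q ^+ 2) ^+ 2))
  <= - (1 / (8 * pi ^+ 2)).
Proof.
move=> ca cw w0 per aq.
pose f q := cabs (alpha q) ^+ 2 / w q ^+ 2.
have cf : continuous f.
  apply: continuous_divX => //; last by move=> x; rewrite gt_eqF.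
  rewrite (_ : (fun q => _) = fun q => complex.Re (conjc (alpha q) * alpha q)).
    by case: (cplx_continuousM (cplx_continuous_conjc ca) ca).
  by apply/funext => x; rewrite cabs_sqr_conjc.
have f0 x : 0 <= f x by rewrite divr_ge0 // sqr_ge0.
have fq : 0 < f q.
  by rewrite divr_gt0 ?exprn_gt0 // cabs_gt0.
have I0 : 0 < int_torus f by exact: int_torus_gt0 _ cf per f0 fq.
have -> : (fun q => complex.Im (alpha q * conjc ('i%C * alpha q)) ^+ 2 / w q ^+ 4) =
          (fun q => f q ^+ 2).
  apply/funext => x; rewrite /f cabs_sqr.
  have : w x != 0 by rewrite gt_eqF.
  by case: (alpha x) => u v wx /=; field.
have -> : (fun q => cabs ('i%C * alpha q) ^+ 2 / w q ^+ 2) = f.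
  apply/funext => x; rewrite /f !cabs_sqr; congr (_ / _).
  by case: (alpha x) => u v /=; ring.
have -> : (fun q => complex.Re (conjc (alpha q) * ('i%C * alpha q)) / w q ^+ 2) = (fun=> 0).
  apply/funext => x; rewrite /f.
  by case: (alpha x) => u v /=; ring.
rewrite int_torus0 expr0n /= subr0 -/f -expr2.
have := int_torus_sqr cf.
set I := int_torus f; set M := int_torus _ => IM.
have p0 : 0 < pi ^+ 2 :> R by rewrite exprn_gt0 // pi_gt0.
have I20 : 0 < I ^+ 2 by rewrite exprn_gt0.
rewrite mulNr lerN2 ler_pdivrMr ?mulr_gt0 ?pi_gt0 //.
rewrite (_ : 1 / 2 * (M / I ^+ 2) * (8 * pi ^+ 2) = 4 * pi ^+ 2 * M / I ^+ 2); last first.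
  by field; rewrite gt_eqF.
by rewrite ler_pdivlMr // mul1r (le_trans IM) // exprMn; lra.
Qed.

End Curvature.

Theorem theorem8p3 (R : realType) (P A B J : R * R -> 'M[R]_2)
    (p alpha beta : R * R -> R[i])
    (hP : EndSJ0 P) (hp : given_by P p) (hp1 : forall q, cabs (p q) < 1)
    (hJ : associated_metric (metric_of P) J)
    (hA : EndSJ0 A) (halpha : given_by A alpha)
    (hB : EndSJ0 B) (hbeta : given_by B beta) :
  let g := metric_of P in
  let h := tangent_of P in
  let w := fun q => 1 - cabs (p q) ^+ 2 in
  let K := sectional_curvature g (h A) (h B) in
  (lin_indep (h A) (h B) ->
    [/\ K = - (1 / 2) *
            (int_torus (fun q =>
               complex.Im (alpha q * conjc (beta q)) ^+ 2 / w q ^+ 4) /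
             (int_torus (fun q => cabs (alpha q) ^+ 2 / w q ^+ 2) *
              int_torus (fun q => cabs (beta q) ^+ 2 / w q ^+ 2) -
              int_torus (fun q =>
                complex.Re (conjc (alpha q) * beta q) / w q ^+ 2) ^+ 2)),
        (real_valued alpha /\ real_valued beta) \/
        (imaginary_valued alpha /\ imaginary_valued beta) ->
          K = 0
      & (real_valued alpha /\ imaginary_valued beta) \/
        (imaginary_valued alpha /\ real_valued beta) ->
          K = - (1 / 2) *
            (int_torus (fun q =>
               complex.Im (alpha q * beta q) ^+ 2 / w q ^+ 4) /
             (int_torus (fun q => cabs (alpha q) ^+ 2 / w q ^+ 2) *
              int_torus (fun q => cabs (beta q) ^+ 2 / w q ^+ 2)))]) /\
  ((exists q, h A q != 0) ->
    sectional_curvature g (h A) (bJ J (h A)) <= - (1 / (8 * pi ^+ 2))).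
Proof.
move=> g h w K.
have Pp q : P q = antilinear_mx (p q) by exact: given_by_mx.
have w_gt0 q : 0 < w q by exact: one_sub_cabs_gt0.
have w0 q : w q != 0 by rewrite gt_eqF.
have ca := given_by_continuous hA halpha.
have cb := given_by_continuous hB hbeta.
have cw : continuous w.
  have cp := given_by_continuous hP hp.
  have [cpp _] := cplx_continuousM (cplx_continuous_conjc cp) cp.
  rewrite (_ : w = fun q => 1 - complex.Re (conjc (p q) * p q)).
    by move=> q; exact: (continuousB (@cst_continuous (R * R)%type R 1 q) (cpp q)).
  by apply/funext => q; rewrite /w cabs_sqr_conjc.
have uN q : 1%:M - P q \in unitmx by rewrite Pp; have [] := cayley_mx (hp1 q).
pose N q := 1%:M - P q.
have rA q : raise g (h A) q =
    (2 / w q) *: (N q *m antilinear_mx (alpha q) *m invmx (N q)).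
  by rewrite -(given_by_mx _ halpha); exact: raise_tangent_of.
have rB q : raise g (h B) q =
    (2 / w q) *: (N q *m antilinear_mx (beta q) *m invmx (N q)).
  by rewrite -(given_by_mx _ hbeta); exact: raise_tangent_of.
have rJ q : raise g (bJ J (h A)) q =
    (2 / w q) *: (N q *m antilinear_mx ('i%C * alpha q) *m invmx (N q)).
  rewrite -antilinear_mx_J0 -(given_by_mx _ halpha).
  exact: raise_bJ_tangent_of.
split.
  move=> _.
  have KE := curvature_formula _ _ _ N w _ _ uN w0 cw ca cb rA rB.
  split=> // reim; rewrite /K KE.
    rewrite (_ : (fun q => complex.Im _ ^+ 2 / _) = fun=> 0).
      by rewrite int_torus0 mul0r mulr0.
    apply/funext => q; case: reim => -[/(_ q) + /(_ q)];
      case: (alpha q) (beta q) => a b [c d] /= -> ->; ring.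
  rewrite (_ : (fun q => complex.Re _ / _) = fun=> 0).
    rewrite int_torus0 expr0n subr0; congr (_ * (int_torus _ / _)).
    apply/funext => q; case: reim => -[/(_ q) + /(_ q)];
      case: (alpha q) (beta q) => a b [c d] /= -> ->; congr (_ / _); ring.
  apply/funext => q; case: reim => -[/(_ q) + /(_ q)];
    case: (alpha q) (beta q) => a b [c d] /= -> ->; ring.
case=> q0 hq0.
have ci : cplx_continuous (fun _ : R * R => 'i%C : R[i]).
  by split; exact: cst_continuous.
rewrite (curvature_formula _ _ _ N w _ _ uN w0 cw ca (cplx_continuousM ci ca) rA rJ).
apply: (holomorphic_bound alpha w q0) => //.
- have per_of (Q : R * R -> 'M[R]_2) (z : R * R -> R[i]) : EndSJ0 Q -> given_by Q z ->
        forall x y, z (x + 2 * pi, y) = z (x, y) /\ z (x, y + 2 * pi) = z (x, y).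
      move=> [sQ _ _] hQ x y.
      have E q q' : Q q ord0 ord0 = Q q' ord0 ord0 ->
          Q q ord0 ord_max = Q q' ord0 ord_max -> z q = z q'.
        rewrite !(given_by_mx _ hQ) !mxE /= !expr0 !mul1r.
        by case: (z q) (z q') => a b [c d] /= -> /oppr_inj ->.
      have [/(_ x y)[x0 y0] _] := sQ ord0 ord0.
      by have [/(_ x y)[x1 y1] _] := sQ ord0 ord_max; split; apply: E.
    move=> x y; rewrite /w.
    have [-> ->] := per_of _ _ hA halpha x y.
    by have [-> ->] := per_of _ _ hP hp x y.
- apply: contra hq0 => /eqP a0; apply/eqP.
    rewrite /h /tangent_of (given_by_mx _ halpha) a0.
    have -> : antilinear_mx (0 : R[i]) = 0.
      by apply: matrix2P; rewrite !mxE /= ?mulr0 ?oppr0.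
    by rewrite mulmx0 mul0mx mulmx0 scaler0.
Qed.
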